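(* Let $n\ge 0$, $r\ge1$, $\ell\ge2$ be integers. For each $r$-multipartition $\lambda^\bullet$ of size $n$ and each $\ell$-multicharge $s\in(\mathbb{Z}/\ell\mathbb{Z})^r$, $$\Lambda^{s'}\equiv\Lambda^+_{\lambda^\bullet,s}\pmod{\delta^\Gamma},$$ where $(\gamma^\bullet,s')$ is the $\ell$-core of $(\lambda^\bullet,s)$.
   Context: Lie theory. Let $C_\Gamma$ be the affine Cartan matrix of type $A^{(1)}_{\ell-1}$ with index set $\mathbb{Z}/\ell\mathbb{Z}$, $(\mathfrak{h},(\alpha_i),(\alpha_i^\vee))$ a realization with $\dim\mathfrak{h}=\ell+1$, $\mathfrak{g}$ the associated affine Lie algebra, $W_\Gamma$ its Weyl group acting on $\mathfrak{h}^*$ by $*$ (the usual linear reflection action), $Q_\Gamma=\bigoplus_i\mathbb{Z}\alpha_i$, $\delta^\Gamma=\sum_i\alpha_i$ the null root. The fundamental weights $\Lambda_i$ satisfy $\Lambda_i(\alpha_j^\vee)=\delta_{ij}$ and vanish on a fixed $D\in\mathfrak{h}$ with $\alpha_0(D)=1$, $\alpha_j(D)=0$ for $j\neq0$. For $x,y\in\mathfrak{h}^*$, $x\equiv y\pmod{\delta^\Gamma}$ means $x-y\in\mathbb{Z}\delta^\Gamma$. For $s\in(\mathbb{Z}/\ell\mathbb{Z})^r$ put $\Lambda^s=\sum_{j=1}^r\Lambda_{s_j}$. $L(\Lambda)$ is the irreducible integrable highest weight module with dominant highest weight $\Lambda$, $P(\Lambda)$ its set of weights; a weight $\eta\in P(\Lambda)$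 is maximal if $\eta+k\delta^\Gamma\notin P(\Lambda)$ for all $k>0$; $P^{++}(\Lambda)$ is the set of maximal dominant weights. Multipartitions and $\Lambda^+$. Partitions are non-increasing functions $\lambda:\mathbb{Z}_{\ge0}\to\mathbb{Z}_{\ge0}$ with finite sum; an $r$-multipartition is an $r$-tuple $(\lambda^1,\dots,\lambda^r)$ of partitions. Its nodes are the $(a,b,c)\in\mathbb{Z}_{\ge0}^2\times\{1,\dots,r\}$ with $b<\lambda^c_a$; such a node of $(\lambda^\bullet,s)$ has residue $\overline{b-a}+s_c\in\mathbb{Z}/\ell\mathbb{Z}$. $\mathrm{Res}_\ell(\lambda^\bullet,s)=\sum_i d_i\alpha_i\in Q_\Gamma$ with $d_i$ the number of nodes of residue $i$. One has $\Lambda^s-\mathrm{Res}_\ell(\lambda^\bullet,s)\in P(\Lambda^s)$, and there is a unique pair $(\Lambda^+_{\lambda^\bullet,s},k_{\lambda^\bullet,s})\in P^{++}(\Lambda^s)\times\mathbb{Z}_{\ge0}$ such that $\omega*(\Lambda^s-\mathrm{Res}_\ell(\lambda^\bullet,s))=\Lambda^+_{\lambda^\bullet,s}-k_{\lambda^\bullet,s}\delta^\Gamma$ for some $\omega\in W_\Gamma$. Abaci. An $r$-abacus is a map $A:\mathbb{Z}\times\{1,\dots,r\}\to\{0,1\}$ such that for some $a\ge0$, $A(k,j)=1$ for all $k<-a$ and $A(k,j)=0$ for all $k>a$, for all $j$. For an $r$-multipartition $\lambda^\bullet$ and $\mathfrak{s}\in\mathbb{Z}^r$, $A_{\lambda^\bullet,\mathfrak{s}}(k,j)=1$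 iff $k=\lambda^j_i-i+\mathfrak{s}_j$ for some $i\in\mathbb{Z}_{\ge0}$; every $r$-abacus is $A_{\lambda^\bullet,\mathfrak{s}}$ for a unique $(\lambda^\bullet,\mathfrak{s})$. An $\ell$-elementary operation at $(i,j)$: if $j<r$, $A(i,j)=1$ and $A(i,j+1)=0$, exchange these two values; if $j=r$, $A(i,r)=1$ and $A(i-\ell,1)=0$, exchange these two values. $\ell$-core. Given $(\lambda^\bullet,s)$, let $\mathfrak{s}\in\{0,\dots,\ell-1\}^r$ be the representative of $s$ and let $\sigma_s\in\mathfrak{S}_r$ be the permutation with $\mathfrak{s}_{\sigma_s(1)}\le\dots\le\mathfrak{s}_{\sigma_s(r)}$ and $\sigma_s(i)<\sigma_s(i+1)$ whenever $\mathfrak{s}_{\sigma_s(i)}=\mathfrak{s}_{\sigma_s(i+1)}$. Let $A$ be the $r$-abacus of $((\lambda^{\sigma_s(1)},\dots,\lambda^{\sigma_s(r)}),(\mathfrak{s}_{\sigma_s(1)},\dots,\mathfrak{s}_{\sigma_s(r)}))$. Perform $\ell$-elementary operations starting from $A$ until none is possible (the result does not depend on the order); the resulting abacus is $A_{\gamma^\bullet,\mathfrak{s}'}$, and the $\ell$-core of $(\lambda^\bullet,s)$ is $(\gamma^\bullet,s')$ with $s'=\mathfrak{s}'\bmod\ell$. *)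

(* Defs.v *)
(* The ground field is C = R[i] for R : realType. *)
From Stdlib Require Export Relation_Operators.
From HB Require Export structures.
From mathcomp Require Export all_boot all_order all_algebra all_fingroup finmap.
From mathcomp Require Export boolp classical_sets cardinality fsbigop reals.
From mathcomp Require Export complex.
Set Implicit Arguments.
Unset Strict Implicit.
Unset Printing Implicit Defensive.
Import Order.TTheory GRing.Theory Num.Theory.
Local Open Scope ring_scope.
Local Open Scope complex_scope.

(* For 2 < l the matrix has 2 on the diagonal, -1 at cyclically adjacent
   indices and 0 elsewhere; for l = 2 the two neighbours coincide and the
   off-diagonal entries are -2. 'Z_l is Z/lZ only for 1 < l. *)
Definition affine_cartan (l : nat) (i j : 'Z_l) : int :=
  (i == j)%:Z *+ 2 - (i == j + 1)%:Z - (j == i + 1)%:Z.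


(* [coroot i] is alpha_i^vee and [root_ j] is alpha_j. *)
Record realization (R : realType) (l : nat) := Realization {
  cartan_alg :> vectType R[i];
  root_ : 'Z_l -> 'Hom(cartan_alg, R[i]^o);
  coroot : 'Z_l -> cartan_alg;
  root_free : free [seq root_ i | i : 'Z_l];
  coroot_free : free [seq coroot i | i : 'Z_l];
  root_coroot : forall i j, root_ j (coroot i) = (affine_cartan i j)%:~R;
  cartan_alg_dim : \dim (fullv : {vspace cartan_alg}) = l.+1 }.

Section AffineWeights.
Variables (R : realType) (l : nat) (h : realization R l).
Implicit Types (x y : 'Hom(h, R[i]^o)).

Definition null_root : 'Hom(h, R[i]^o) := \sum_(i : 'Z_l) root_ h i.

Definition eq_mod_null_root x y : Prop := exists m : int, x - y = null_root *~ m.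

Definition simple_reflection (i : 'Z_l) x : 'Hom(h, R[i]^o) :=
  x - x (coroot h i) *: root_ h i.

(* The simple reflections are involutions, so the monoid they generate is a
   group. *)
Inductive weyl_group : ('Hom(h, R[i]^o) -> 'Hom(h, R[i]^o)) -> Prop :=
| weyl_id : weyl_group id
| weyl_mul i w : weyl_group w -> weyl_group (simple_reflection i \o w).

Definition is_scaling_element (D : h) : Prop :=
  root_ h 0 D = 1 /\ forall j, j != 0 -> root_ h j D = 0.

Definition is_fundamental_weights (D : h) (Lam : 'Z_l -> 'Hom(h, R[i]^o)) : Prop :=
  forall i, (forall j, Lam i (coroot h j) = (i == j)%:R) /\ Lam i D = 0.

Definition charge_weight (Lam : 'Z_l -> 'Hom(h, R[i]^o)) (r : nat)
    (s : 'I_r -> 'Z_l) : 'Hom(h, R[i]^o) := \sum_(j < r) Lam (s j).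

Definition dominant x : Prop :=
  forall i, exists m : nat, x (coroot h i) = m%:R.

End AffineWeights.

Record lieAlgebra (K : fieldType) := LieAlgebra {
  lie_sort :> lmodType K;
  bracket : lie_sort -> lie_sort -> lie_sort;
  bracket_linearl : forall y, linear (bracket^~ y);
  bracket_linearr : forall x, linear (bracket x);
  bracket_alt : forall x, bracket x x = 0;
  bracket_jacobi : forall x y z,
    bracket x (bracket y z) + bracket y (bracket z x)
    + bracket z (bracket x y) = 0 }.

Definition is_subspace (K : fieldType) (V : lmodType K) (S : set V) : Prop :=
  S 0 /\ forall (a : K) u v, S u -> S v -> S (a *: u + v).

Definition is_lie_subalgebra (K : fieldType) (g : lieAlgebra K) (S : set g) : Prop :=
  is_subspace S /\ forall x y, S x -> S y -> S (bracket x y).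

Definition is_lie_ideal (K : fieldType) (g : lieAlgebra K) (S : set g) : Prop :=
  is_subspace S /\ forall x y, S y -> S (bracket x y).

(* The Kac-Moody algebra g(A) of the realization: it is generated by h and the
   Chevalley generators e_i, f_i, which satisfy the defining relations of
   \tilde g(A), and it has no nonzero ideal meeting h trivially. *)
Record affineLieAlgebra (R : realType) (l : nat) (h : realization R l) :=
  AffineLieAlgebra {
  affine_lie :> lieAlgebra R[i];
  cartan_inj : {linear h -> affine_lie};
  chev_e : 'Z_l -> affine_lie;
  chev_f : 'Z_l -> affine_lie;
  cartan_injP : injective cartan_inj;
  bracket_ef : forall i j, bracket (chev_e i) (chev_f j)
    = if i == j then cartan_inj (coroot h i) else 0;
  bracket_hh : forall x y, bracket (cartan_inj x) (cartan_inj y) = 0;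
  bracket_he : forall x i,
    bracket (cartan_inj x) (chev_e i) = root_ h i x *: chev_e i;
  bracket_hf : forall x i,
    bracket (cartan_inj x) (chev_f i) = - root_ h i x *: chev_f i;
  affine_lie_gen : forall S : set affine_lie, is_lie_subalgebra S ->
    (forall x, S (cartan_inj x)) -> (forall i, S (chev_e i)) ->
    (forall i, S (chev_f i)) -> forall x, S x;
  affine_lie_ideal : forall I : set affine_lie, is_lie_ideal I ->
    (forall x, I (cartan_inj x) -> x = 0) -> forall x, I x -> x = 0 }.

Record lieModule (K : fieldType) (g : lieAlgebra K) := LieModule {
  module_sort :> lmodType K;
  act : g -> module_sort -> module_sort;
  act_linearl : forall v, linear (act^~ v);
  act_linearr : forall x, linear (act x);
  act_bracket : forall x y v,
    act (bracket x y) v = act x (act y v) - act y (act x v) }.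

Section AffineModules.
Variables (R : realType) (l : nat) (h : realization R l).
Variables (g : affineLieAlgebra h) (L : lieModule g).

Definition is_submodule (S : set L) : Prop :=
  is_subspace S /\ forall x v, S v -> S (act x v).

Definition irreducible_module : Prop :=
  (exists v : L, v != 0) /\
  forall S : set L, is_submodule S -> (forall v, S v -> v = 0) \/ (forall v, S v).

Definition is_weight_vector (eta : 'Hom(h, R[i]^o)) (v : L) : Prop :=
  forall x : h, act (cartan_inj g x) v = (eta x : R[i]) *: v.

Definition weights (eta : 'Hom(h, R[i]^o)) : Prop :=
  exists2 v : L, v != 0 & is_weight_vector eta v.

Definition integrable_module : Prop :=
  [/\ forall S : set L, is_subspace S ->
        (forall eta v, is_weight_vector eta v -> S v) -> forall v, S v,
      forall i (v : L), exists N, iter N (act (chev_e g i)) v = 0 &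
      forall i (v : L), exists N, iter N (act (chev_f g i)) v = 0].

Definition highest_weight_module (Lam : 'Hom(h, R[i]^o)) : Prop :=
  exists v : L, [/\ v != 0, is_weight_vector Lam v,
    forall i, act (chev_e g i) v = 0 &
    forall S : set L, is_submodule S -> S v -> forall u, S u].

(* L is L(Lam); it is determined by Lam up to isomorphism. *)
Definition is_irreducible_hw_module (Lam : 'Hom(h, R[i]^o)) : Prop :=
  [/\ dominant Lam, irreducible_module, integrable_module &
      highest_weight_module Lam].

Definition maximal_weight (eta : 'Hom(h, R[i]^o)) : Prop :=
  weights eta /\ forall k : nat, (0 < k)%N -> ~ weights (eta + null_root h *+ k).

Definition maximal_dominant_weight (eta : 'Hom(h, R[i]^o)) : Prop :=
  maximal_weight eta /\ dominant eta.

End AffineModules.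

Record partition := Partition {
  part_fun :> nat -> nat;
  part_noninc : forall a b, (a <= b)%N -> (part_fun b <= part_fun a)%N;
  part_finite : exists m, forall a, (m <= a)%N -> part_fun a = 0%N }.

Definition multipartition (r : nat) := 'I_r -> partition.

Section Multipartitions.
Variables (l r : nat).
Implicit Types (lam : multipartition r) (s : 'I_r -> 'Z_l).

Definition multipartition_size lam : nat :=
  \sum_(c < r) \sum_(a \in [set: nat]%classic) lam c a.

Definition nodes lam : set (nat * nat * 'I_r) :=
  [set x | (x.1.2 < lam x.2 x.1.1)%N]%classic.

Definition residue s (x : nat * nat * 'I_r) : 'Z_l :=
  x.1.2%:R - x.1.1%:R + s x.2.

Definition residue_count lam s (i : 'Z_l) : nat :=
  #|` fset_set [set x | nodes lam x /\ residue s x = i]%classic|%fset.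

Definition Res (R : realType) (h : realization R l) lam s : 'Hom(h, R[i]^o) :=
  \sum_(i : 'Z_l) root_ h i *+ residue_count lam s i.

End Multipartitions.

(* (Lp, k) is the pair (Lambda^+, k) attached to (lam, s), where L = L(Lambda^s). *)
Definition is_plus_pair (R : realType) (l r : nat) (h : realization R l)
    (Lam : 'Z_l -> 'Hom(h, R[i]^o)) (g : affineLieAlgebra h) (L : lieModule g)
    (lam : multipartition r) (s : 'I_r -> 'Z_l)
    (Lp : 'Hom(h, R[i]^o)) (k : nat) : Prop :=
  maximal_dominant_weight L Lp /\
  exists2 w, weyl_group w &
    w (charge_weight Lam s - Res h lam s) = Lp - null_root h *+ k.

(* Components are indexed from 0: 'I_r stands for {1, ..., r}. The configurations
   that are r-abaci (all 1 far to the left, all 0 far to the right) are exactly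
   those of the form [abacus_of lam c], and elementary operations preserve them. *)
Section Abaci.
Variables (l r : nat).

Definition bead_config := (int * 'I_r -> bool)%type.

Definition abacus_of (lam : multipartition r) (c : 'I_r -> int) : bead_config :=
  fun x => `[< exists i : nat, x.1 = (lam x.2 i)%:Z - i%:Z + c x.2 >].

(* [ordS] is the cyclic successor, so the last component is followed by the
   first one. *)
Definition elementary_target (x : int * 'I_r) : int * 'I_r :=
  if x.2.+1 == r then (x.1 - l%:Z, ordS x.2) else (x.1, ordS x.2).

Definition exchange (x y : int * 'I_r) (A : bead_config) : bead_config :=
  fun z => if z == x then A y else if z == y then A x else A z.

Definition elementary_op (A B : bead_config) : Prop :=
  exists x, [/\ A x = true, A (elementary_target x) = false &
                B = exchange x (elementary_target x) A].

Definition is_sorting_perm (s : 'I_r -> 'Z_l) (sigma : 'S_r) : Prop :=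
  forall i j : 'I_r, j = i.+1 :> nat ->
    (s (sigma i) <= s (sigma j))%N /\
    (s (sigma i) = s (sigma j) -> (sigma i < sigma j)%N).

Definition is_core (lam : multipartition r) (s : 'I_r -> 'Z_l)
    (gam : multipartition r) (s' : 'I_r -> 'Z_l) : Prop :=
  exists (sigma : 'S_r) (c' : 'I_r -> int) (B : bead_config),
  [/\ is_sorting_perm s sigma,
      clos_refl_trans _ elementary_op
        (abacus_of (lam \o sigma) (fun j => (s (sigma j) : nat)%:Z)) B,
      forall C, ~ elementary_op B C,
      B = abacus_of gam c' &
      forall j, s' j = (c' j)%:~R].

End Abaci.

(* Main.v *)
Require Import Defs.
From mathcomp Require Import zify ring.
Set Implicit Arguments.
Unset Strict Implicit.
Unset Printing Implicit Defensive.
Import Order.TTheory GRing.Theory Num.Theory.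
Local Open Scope ring_scope.
Local Open Scope complex_scope.

(* Modulo the null root a weight is determined by its values on the coroots, so
   the module L only enters through the dominance of Lambda^+.  Let F_j(i) be the
   regularized number of beads of column j at positions congruent to i mod l.
   For the weight Lambda^s - Res, the value on the i-th coroot is
   sum_j (F_j(i) - F_j(i+1)), with F_j extended to Z by F_j(i+l) = F_j(i) - 1, and
   elementary operations preserve sum_j F_j.  An abacus without elementary
   operations is balanced: F_1 <= ... <= F_r <= F_1 + 1.  Simple reflections
   exchange F_j(i) and F_j(i+1) for all j at once; this keeps F balanced and
   preserves sum_i F_j(i), which is s'_j + 1 mod l.  Once a dominant weight is
   reached, each F_j is non-increasing, hence drops exactly once per period, at
   the residue s'_j: the weight has the coroot values of Lambda^{s'}. *)

Lemma sum_eq_op (I : finType) (a : I) : \sum_i (i == a)%:Z = 1.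
Proof. by rewrite (bigD1 a) //= eqxx big1 ?addr0 // => i /negbTE ->. Qed.

(** * Level vectors: reflections, balance and dominance *)

Section LevelVectors.
Variables (r l : nat).
Implicit Types (F : 'I_r -> 'Z_l -> int).

(* The values [f i] are those of a function on Z with [f (i + l) = f i - 1] at
   representatives in [0, l); stepping from [-1] to [0] wraps around. *)
Definition drop_at (f : 'Z_l -> int) (i : 'Z_l) : int :=
  f i - f (i + 1) + (i == -1)%:Z.

Definition balanced F := forall i (j j' : 'I_r), (j <= j')%N ->
  F j i <= F j' i <= F j i + 1.

(** Exchange of the values at [i] and [i + 1] of the extension to Z: [f i - drop_at f i] is
    [f (i + 1)], lowered by 1 when the step wraps. *)
Definition reflect_at (i : 'Z_l) (f : 'Z_l -> int) (k : 'Z_l) : int :=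
  if k == i then f i - drop_at f i
  else if k == i + 1 then f (i + 1) + drop_at f i else f k.

Lemma reflect_atE i f k :
  reflect_at i f k = f k + drop_at f i * ((k == i + 1)%:Z - (k == i)%:Z).
Proof.
have ne : (i == i + 1) = false.
  by apply/negbTE; rewrite -[X in X == _]addr0 (inj_eq (addrI i)) eq_sym oner_eq0.
rewrite /reflect_at; case: eqVneq => [->|_]; first by rewrite ne /=; ring.
by case: eqVneq => [->|_] /=; ring.
Qed.

(** Drops transform under [reflect_at i] as coroot values do under the [i]-th simple reflection,
    since [affine_cartan k i] is the value of the [i]-th root on the [k]-th coroot. *)
Lemma drop_at_reflect i f k :
  drop_at (reflect_at i f) k = drop_at f k - drop_at f i * affine_cartan k i.
Proof.
rewrite [LHS]/drop_at !reflect_atE /affine_cartan.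
rewrite (inj_eq (addIr 1)) (eq_sym (k + 1) i) /drop_at; ring.
Qed.

Lemma sum_reflect_at i f : \sum_k reflect_at i f k = \sum_k f k.
Proof.
under eq_bigr do rewrite reflect_atE.
rewrite big_split /= -mulr_sumr big_split /= sumrN.
by rewrite !sum_eq_op subrr mulr0 addr0.
Qed.

(** Balance is tested residue by residue, and all columns undergo the same exchange with the same
    wrap correction. *)
Lemma balanced_reflect i F :
  balanced F -> balanced (fun j => reflect_at i (F j)).
Proof.
move=> bF k j j' jj'; rewrite /reflect_at /drop_at.
have := bF i _ _ jj'; have := bF (i + 1) _ _ jj'; have := bF k _ _ jj'.
by case: eqP => // _; [|case: eqP => // _]; case: (i == -1); lia.
Qed.

Lemma sum_drop_at f : \sum_i drop_at f i = 1.
Proof.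
rewrite big_split /= big_split /= sumrN.
rewrite [X in _ - X](_ : _ = \sum_i f i).
  by rewrite subrr add0r sum_eq_op.
by rewrite [RHS](reindex_inj (addIr 1)).
Qed.

Lemma nneg_sum1 (I : finType) (f : I -> int) :
  (forall i, 0 <= f i) -> \sum_i f i = 1 -> exists p, forall i, f i = (i == p)%:Z.
Proof.
move=> f0 f1.
have [p fp] : exists p, 0 < f p.
  apply/existsP; apply: contraPT isT => /existsPn H _.
  have : \sum_i f i <= 0 by apply: sumr_le0 => i _; move: (H i); rewrite -leNgt.
  by rewrite f1.
exists p => i; move: f1; rewrite (bigD1 p) //=.
case: eqVneq => [->|ip].
  have : 0 <= \sum_(i | i != p) f i by apply: sumr_ge0.
  by move: (\sum_(i | i != p) f i) => S; lia.
rewrite (bigD1 i) //=.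
have : 0 <= \sum_(j | (j != p) && (j != i)) f j by apply: sumr_ge0.
by move: (\sum_(j | _) f j) (f0 i) => S; lia.
Qed.

(* Summation by parts: [\sum_i i (f i - f (i + 1)) = \sum_i f i]. *)
Lemma drop_at_position f (p : 'Z_l) :
  (forall i, drop_at f i = (i == p)%:Z) -> p = (\sum_i f i)%:~R - 1.
Proof.
move=> fp.
have : \sum_i i * (drop_at f i)%:~R = p.
  under eq_bigr do rewrite fp.
  rewrite (bigD1 p) //= eqxx mulr1 big1 ?addr0 // => i /negbTE ->.
  by rewrite mulr0.
move=> <-; rewrite /drop_at.
under eq_bigr do rewrite intrD intrB mulrDr mulrBr.
rewrite big_split /= big_split /= sumrN.
(* The wrap term is supported at the residue -1; it yields the -1 of the statement. *)
rewrite [X in _ + X](_ : _ = -1); last first.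
  rewrite (bigD1 (-1)) //= eqxx mulr1 big1 ?addr0 // => i /negbTE ->.
  by rewrite mulr0.
congr (_ - _).
rewrite (reindex_inj (addIr 1)) -sumrB rmorph_sum /= [RHS](reindex_inj (addIr 1)).
by apply: eq_bigr => i _ /=; ring.
Qed.

(** By balance, the drops of two columns at [i] differ by at most 1. One negative drop would thus
    make all of them nonpositive and their sum negative. *)
Lemma balanced_drop_ge0 F i : balanced F ->
  0 <= \sum_j drop_at (F j) i -> forall j, 0 <= drop_at (F j) i.
Proof.
move=> bF s0 j; rewrite leNgt; apply/negP => neg; move: s0; rewrite leNgt => /negP; apply.
rewrite (bigD1 j) //= -[ltRHS]addr0; apply: ltr_leD => //.
apply: sumr_le0 => j' _; move: neg; rewrite /drop_at.
case/orP: (leq_total j j') => jj'.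
all: have := bF i _ _ jj'; have := bF (i + 1) _ _ jj'; lia.
Qed.

(** Each column has nonnegative drops with sum 1, hence a single drop, and its column sum locates
    it. *)
Lemma dominant_balanced F : balanced F ->
  (forall i, 0 <= \sum_j drop_at (F j) i) ->
  forall i, \sum_j drop_at (F j) i
    = \sum_j (((\sum_k F j k)%:~R - 1 : 'Z_l) == i)%:Z.
Proof.
move=> bF dF i; apply: eq_bigr => j _.
have [p fp] : exists p, forall i, drop_at (F j) i = (i == p)%:Z.
  apply: nneg_sum1; last exact: sum_drop_at.
  by move=> k; apply: balanced_drop_ge0.
by rewrite fp -(drop_at_position fp) eq_sym.
Qed.
End LevelVectors.

(** * Bead counts by residue, and how they compare between columns *)

(* Positions are cut off to [- K l, K l); subtracting [K] then makes the count
   independent of [K] for a bead configuration that is full below [- K l] and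
   empty from [K l] on. *)
Definition runner (l K : nat) (P : int -> bool) (i : 'Z_l) : int :=
  \sum_(t < 2 * (K * l)) (P (t%:Z - (K * l)%:Z) && (t%:R == i))%:Z - K%:Z.

Definition node_count (l M : nat) (p : partition) (c i : 'Z_l) : nat :=
  \sum_(a < M) \sum_(b < p a) (b%:R - a%:R + c == i :> 'Z_l)%R.

Lemma le_runner l K (P Q : int -> bool) (i : 'Z_l) :
  (forall k, P k -> Q k) -> runner K P i <= runner K Q i.
Proof.
move=> PQ; rewrite lerD2r; apply: ler_sum => t _; rewrite lez_nat.
by case: (P _) (PQ (t%:Z - (K * l)%:Z)) => //= /(_ isT) ->.
Qed.

(** Translation by [l] keeps residues and sends the beads of [P] past the first [l] cells of the
    window to beads of [Q]. The first [l] cells meet the residue [i] once, whence the 1. *)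
Lemma le_runner_shift l K (P Q : int -> bool) (i : 'Z_l) :
  (1 < l)%N -> (0 < K)%N -> (forall k, P k -> Q (k - l%:Z)) ->
  runner K P i <= runner K Q i + 1.
Proof.
move=> hl K0 PQ; rewrite /runner addrAC lerD2r.
have lB : (l <= 2 * (K * l))%N by nia.
rewrite -(big_mkord xpredT (fun t : nat => (P (t%:Z - (K * l)%:Z) && (t%:R == i))%:Z)).
rewrite (big_cat_nat _ lB) //= addrC; apply: lerD; last first.
  rewrite big_mkord; apply: (@le_trans _ _ (\sum_(t < l) (t%:R == i)%:Z)).
    by apply: ler_sum => t _; rewrite lez_nat; case: (P _); case: (_ == _).
  move: i; case: l hl {PQ lB} => [|[|l]] // _ i.
  rewrite (bigD1 i) //= natr_Zp eqxx big1 ?addr0 // => j /negbTE.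
  by rewrite natr_Zp => ->.
rewrite -{1}[l]add0n big_addn.
apply: (@le_trans _ _ (\sum_(0 <= t < 2 * (K * l) - l)
   (Q (t%:Z - (K * l)%:Z) && (t%:R == i))%:Z)).
  rewrite ler_sum // => t _; rewrite lez_nat natrD pchar_Zp // addr0.
  move: (PQ ((t + l)%N%:Z - (K * l)%:Z)).
  rewrite (_ : _ - l%:Z = t%:Z - (K * l)%:Z); last by lia.
  by case: (P _) => //= /(_ isT) ->.
have lB' : (2 * (K * l) - l <= 2 * (K * l))%N by lia.
rewrite -(big_mkord xpredT (fun t : nat => (Q (t%:Z - (K * l)%:Z) && (t%:R == i))%:Z)).
by rewrite [leRHS](big_cat_nat _ lB') //= lerDl sumr_ge0.
Qed.

(** * The column of a single partition *)

Section Column.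
Variables (l K M : nat) (p : partition) (c : int).
Hypotheses (hl : (1 < l)%N) (p0 : forall a, (M <= a)%N -> p a = 0%N).
Hypothesis leK : (M + `|c| + p 0 < K)%N.
Let P (k : int) := `[< exists a : nat, k = (p a)%:Z - a%:Z + c >].
(** The number of beads at positions at least [- K l]: from row [M] on, the bead of row [a] sits at
    [c - a]. *)
Let N : nat := `|c + (K * l)%:Z + 1|.
Let d (i : 'Z_l) : int := (node_count M p c%:~R i)%:Z.

Let leKl : (K <= K * l)%N. Proof. by rewrite leq_pmulr // ltnW. Qed.
Let NE : N%:Z = c + (K * l)%:Z + 1. Proof. by rewrite /N; lia. Qed.
Let MN : (M <= N)%N. Proof. by move: NE leKl leK; lia. Qed.
Let Kl0 : (K * l)%:Z%:~R = 0 :> 'Z_l.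
Proof. by rewrite -pmulrn natrM pchar_Zp // mulr0. Qed.

Lemma sum_beads (G : 'Z_l -> int) :
  \sum_(t < 2 * (K * l) | P (t%:Z - (K * l)%:Z)) G t%:R
    = \sum_(a < N) G (((p a)%:Z - a%:Z + c)%:~R).
Proof.
have pos (a : nat) : (a < N)%N -> 0 <= (p a)%:Z - a%:Z + c + (K * l)%:Z.
  by move: NE; lia.
have lt (a : 'I_N) : (`|((p a)%:Z - a%:Z + c + (K * l)%:Z)%R| < 2 * (K * l))%N.
  have := pos a (ltn_ord a); have := part_noninc p (leq0n a).
  by move: leKl leK; lia.
pose h a := Ordinal (lt a).
have hE a : (h a)%:Z = (p a)%:Z - a%:Z + c + (K * l)%:Z.
  by have := pos a (ltn_ord a); rewrite /=; lia.
have hinj : injective h.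
  move=> a b /(congr1 (fun t : 'I__ => t%:Z)); rewrite !hE => e.
  apply: val_inj => /=; case: (leqP a b) => ab.
    by have := part_noninc p ab; lia.
  by have := part_noninc p (ltnW ab); lia.
transitivity (\sum_(t in h @: [set: 'I_N]) G t%:R).
  apply: eq_bigl => t; apply/asboolP/imsetP => [[a e]|[a _ ->]]; last first.
    by exists a; rewrite hE; lia.
  have aN : (a < N)%N.
    rewrite ltnNge; apply/negP => Na.
    by move: e; rewrite p0 ?(leq_trans MN) //; move: NE; lia.
  exists (Ordinal aN); rewrite ?inE //; apply: val_inj.
  by have := hE (Ordinal aN); move: (h _) => u /=; lia.
rewrite big_imset /=; last by move=> a b _ _; apply: hinj.
rewrite big_set; apply: eq_bigr => a _; congr G.
by rewrite [LHS]pmulrn hE [LHS]intrD Kl0 addr0.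
Qed.

(** The bead of row [a] for the empty partition, at position [c - a]. *)
Let vacuum (i : 'Z_l) (a : nat) : int := (c%:~R - a%:R == i :> 'Z_l)%:Z.

(** Row [a] pushes its bead from [c - a] to [c - a + p a], one step per node: a node of residue [k]
    moves the bead from residue [k] to [k + 1]. Summing over the nodes of the row telescopes. *)
Lemma runner_abacus i :
  runner K P i = \sum_(a < N) vacuum i a - K%:Z + d (i - 1) - d i.
Proof.
rewrite /runner.
rewrite (eq_bigr (fun t : 'I__ =>
    if P (t%:Z - (K * l)%:Z) then (t%:R == i)%:Z else 0)); last first.
  by move=> t _; case: (P _).
rewrite -big_mkcond (sum_beads (fun x => (x == i)%:Z)).
rewrite -[RHS]addrA [RHS]addrAC; congr (_ - _).
have row a : (((p a)%:Z - a%:Z + c)%:~R == i)%:Z = vacuum i a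
    + (\sum_(b < p a) (b%:R - a%:R + c%:~R == i - 1)%:Z
       - \sum_(b < p a) (b%:R - a%:R + c%:~R == i)%:Z).
  pose f (b : nat) : int := (b%:R - a%:R + c%:~R == i)%:Z.
  rewrite -sumrB (eq_bigr (fun b : 'I_(p a) => f b.+1 - f b)); last first.
    move=> b _; rewrite /f eq_sym subr_eq eq_sym.
    by congr ((_ == _)%:Z - _); rewrite -natr1; ring.
  rewrite -(big_mkord xpredT (fun b => f b.+1 - f b)) telescope_sumr //.
  rewrite /f /vacuum add0r (addrC (- a%:R)) [RHS]addrC subrK.
  by rewrite !intrD intrN -!pmulrn.
have dE k : d k = \sum_(a < N) \sum_(b < p a) (b%:R - a%:R + c%:~R == k)%:Z.
  rewrite -(big_mkord xpredT (fun a : nat =>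
    \sum_(b < p a) (b%:R - a%:R + c%:~R == k)%:Z)) (big_cat_nat _ MN) //=.
  rewrite [X in _ + X]big_nat_cond [X in _ + X]big1 => [|a]; last first.
    by rewrite andbT => /andP[Ma _]; rewrite p0 // big_ord0.
  rewrite addr0 big_mkord /d /node_count -natz natr_sum.
  by apply: eq_bigr => a _; rewrite natr_sum; apply: eq_bigr => b _; rewrite natz.
by rewrite (eq_bigr _ (fun (a : 'I_N) _ => row a)) big_split /= sumrB -!dE.
Qed.

(** The node counts enter through a second difference, which is row [i] of the Cartan matrix. The
    vacuum part telescopes over the rows from [c] down to [c - N], of residue -1, where it cancels
    the wrap term. *)
Lemma drop_at_runner_abacus i : drop_at (runner K P) i
  = (c%:~R == i)%:Z - \sum_j affine_cartan i j * d j.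
Proof.
have -> : \sum_j affine_cartan i j * d j = d i *+ 2 - d (i - 1) - d (i + 1).
  have delta (k : 'Z_l) : \sum_j (j == k)%:Z * d j = d k.
    by rewrite (bigD1 k) //= eqxx mul1r big1 ?addr0 // => j /negbTE ->; rewrite mul0r.
  rewrite -!delta -!sumrMnl -!sumrB; apply: eq_bigr => j _.
  rewrite /affine_cartan (eq_sym i j).
  have -> : (i == j + 1) = (j == i - 1) by rewrite -subr_eq eq_sym.
  by ring.
have tel : \sum_(a < N) vacuum i a - \sum_(a < N) vacuum (i + 1) a
    = (c%:~R == i)%:Z - (i == -1)%:Z.
  rewrite -sumrB (eq_bigr (fun a : 'I_N => - (vacuum i a.+1 - vacuum i a))).
    rewrite sumrN -(big_mkord xpredT (fun a => vacuum i a.+1 - vacuum i a)).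
    rewrite telescope_sumr // opprB /vacuum subr0; congr (_ - (_ : bool)%:Z).
    by rewrite pmulrn NE !intrD Kl0 addr0 opprD addNKr eq_sym.
  move=> a _; rewrite opprB /vacuum; congr (_ - (_ : bool)%:Z).
  by rewrite -subr_eq -natr1 opprD addrA.
rewrite /drop_at !runner_abacus addrK.
by move: tel; do 2![move: (\sum_(a < N) _) => ?]; lia.
Qed.

(** Node counts cancel around the cycle, so the sum is [N - K l], that is [c + 1]. *)
Lemma sum_runner_abacus : (\sum_(i : 'Z_l) runner K P i)%:~R - 1 = c%:~R :> 'Z_l.
Proof.
under eq_bigr do rewrite runner_abacus.
have dsum : \sum_i d (i - 1) = \sum_i d i by rewrite [RHS](reindex_inj (addIr (- 1))).
rewrite sumrB big_split /= dsum addrK.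
rewrite sumrB exchange_big /=.
rewrite (eq_bigr (fun=> 1)) => [|a _]; last first.
  rewrite (bigD1 (c%:~R - a%:R)) //= /vacuum eqxx big1 ?addr0 // => k.
  by rewrite eq_sym => /negbTE ->.
have -> : \sum_(i : 'Z_l) K%:Z = (K * l)%:Z.
  by rewrite sumr_const card_ord Zp_cast // -mulr_natr natz -PoszM.
rewrite sumr_const card_ord natz NE addrAC addrK.
by rewrite intrD addrK.
Qed.

End Column.

(** * Elementary operations: invariance of the totals, and terminal abaci *)

Section ElementaryOperations.
Variables (l r : nat).
Hypothesis hl : (1 < l)%N.
Implicit Types (A B : bead_config r).

Definition total_runner K A (i : 'Z_l) : int :=
  \sum_j runner K (fun k => A (k, j)) i.

(** The summed drops depend only on the totals over columns, which elementary operations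
    preserve. *)
Lemma sum_drop_at_runner K A i :
  \sum_j drop_at (runner K (fun k => A (k, j))) i
    = total_runner K A i - total_runner K A (i + 1) + (i == -1)%:Z *+ r.
Proof. by rewrite /drop_at big_split /= sumrB sumr_const card_ord. Qed.

Lemma elementary_target_residue (x : int * 'I_r) :
  (elementary_target l x).1%:~R = x.1%:~R :> 'Z_l.
Proof.
rewrite /elementary_target; case: ifP => //= _.
by rewrite intrB -pmulrn pchar_Zp // subr0.
Qed.

Lemma total_runnerE K A i : total_runner K A i =
  \sum_(u : 'I_r * 'I_(2 * (K * l)))
     (A (u.2%:Z - (K * l)%:Z, u.1) && (u.2%:R == i))%:Z - K%:Z *+ r.
Proof.
by rewrite /total_runner sumrB sumr_const card_ord pair_bigA.
Qed.

(** The bead moves to a cell of the same residue, so once both cells lie in the window the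
    transposition of the two reindexes the sum. *)
Lemma total_runner_elementary A B : elementary_op l A B ->
  exists K0, forall K, (K0 <= K)%N -> forall i,
    total_runner K A i = total_runner K B i.
Proof.
case=> x []; set y := elementary_target l x => Ax Ay ->.
exists (`|x.1| + `|y.1| + 1)%N => K leK i.
have leKl : (K <= K * l)%N by rewrite leq_pmulr // ltnW.
pose pos (u : 'I_r * 'I_(2 * (K * l))) := (u.2%:Z - (K * l)%:Z, u.1).
have posP (z : int * 'I_r) : (`|z.1| < K)%N -> exists u, pos u = z.
  move=> zK; have lt : (`|(z.1 + (K * l)%:Z)%R| < 2 * (K * l))%N by lia.
  by exists (z.2, Ordinal lt); rewrite [RHS]surjective_pairing; congr pair; rewrite /=; lia.
have [|ux xE] := posP x; first by lia.
have [|uy yE] := posP y; first by lia.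
have pos_inj : injective pos.
  by move=> [j t] [j' t'] [e ->]; congr pair; apply: val_inj; move: e => /=; lia.
have res : (ux.2%:R = uy.2%:R :> 'Z_l).
  have posres (u : 'I_r * 'I_(2 * (K * l))) : u.2%:R = (pos u).1%:~R :> 'Z_l.
    by rewrite intrB -!pmulrn natrM pchar_Zp // mulr0 subr0.
  by rewrite !posres xE yE elementary_target_residue.
rewrite !total_runnerE; congr (_ - _).
rewrite (reindex_inj (@perm_inj _ (tperm ux uy))).
apply: eq_bigr => u _; rewrite -!/(pos _) /exchange -xE -yE !(inj_eq pos_inj).
have yx : (uy == ux) = false.
  by apply/eqP => e; move: Ax; rewrite -xE -e yE Ay.
by case: tpermP => [->|->|/eqP/negbTE -> /eqP/negbTE ->]; rewrite ?eqxx ?yx ?res.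
Qed.

Lemma total_runner_clos A B : clos_refl_trans _ (@elementary_op l r) A B ->
  exists K0, forall K, (K0 <= K)%N -> forall i,
    total_runner K A i = total_runner K B i.
Proof.
elim=> [{}A {}B|{}A|{}A C {}B _ [K1 h1] _ [K2 h2]].
- exact: total_runner_elementary.
- by exists 0%N.
exists (K1 + K2)%N => K leK i.
by rewrite h1 ?h2 // (leq_trans _ leK) // (leq_addl, leq_addr).
Qed.

(** Each bead has a bead at its target. Iterating, a bead at [k] forces beads at [k] in all later
    columns and, past the last one, at [k - l] in every column; these give the two inequalities. *)
Lemma terminal_balanced B K : (0 < r)%N -> (0 < K)%N -> (forall C, ~ elementary_op l B C) ->
  balanced (fun j (i : 'Z_l) => runner K (fun k => B (k, j)) i).
Proof.
move=> hr K0 term.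
have step x : B x -> B (elementary_target l x).
  move=> Bx; case e: (B _) => //; case: (term (exchange x (elementary_target l x) B)).
  by exists x.
have right k (j j' : 'I_r) : (j <= j')%N -> B (k, j) -> B (k, j').
  case: j' => n; elim: n => [|n IH] lt /=.
    by rewrite leqn0 => /eqP j0; rewrite (_ : j = Ordinal lt) //; apply: val_inj.
  rewrite leq_eqVlt => /orP[/eqP jn|jn].
    by rewrite (_ : j = Ordinal lt) //; apply: val_inj.
  have ltn := ltnW lt; move=> /(IH ltn jn) /step.
  rewrite /elementary_target /= ltn_eqF //.
  rewrite (_ : ordS _ = Ordinal lt) //; apply: val_inj => /=.
  by rewrite modn_small.
have wrap k (j j' : 'I_r) : B (k, j) -> B (k - l%:Z, j').
  have lt : (r.-1 < r)%N by rewrite prednK.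
  move=> /(@right _ _ (Ordinal lt)) h; have /h/step : (j <= r.-1)%N.
    by rewrite -ltnS prednK.
  rewrite /elementary_target /= prednK // eqxx => /right; apply.
  by rewrite /= prednK // modnn.
move=> i j j' jj'; rewrite le_runner => [|k]; last exact: right.
by apply: le_runner_shift => // k; apply: wrap.
Qed.
End ElementaryOperations.

(** * Node counts of a multipartition as sums over its components *)

Lemma residue_countE (l r M : nat) (lam : multipartition r) (s : 'I_r -> 'Z_l) i :
  (forall c a, (M <= a)%N -> lam c a = 0%N) ->
  residue_count lam s i = (\sum_c node_count M (lam c) (s c) i)%N.
Proof.
move=> lam0; pose M' := (\max_c lam c 0%N)%N.
have leM' c a : (lam c a <= M')%N.
  by apply: leq_trans (part_noninc _ (leq0n a)) _; apply: (leq_bigmax c).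
(* A finite box containing all nodes. *)
pose T := ('I_r * ('I_M * 'I_M'))%type.
pose E := [set u : T | (u.2.2 < lam u.1 u.2.1)%N &&
  (u.2.2%:R - u.2.1%:R + s u.1 == i)].
pose node (u : T) : nat * nat * 'I_r := ((u.2.1 : nat), (u.2.2 : nat), u.1).
have node_inj : injective node.
  by move=> [c [a b]] [c' [a' b']] [/val_inj -> /val_inj -> ->].
have -> : residue_count lam s i = #|E|.
  rewrite /residue_count (_ : [set x | _]%classic = [set` [fset node u | u in E]%fset]%classic).
    by rewrite set_fsetK card_imfset // -cardE.
  apply/seteqP; split => [[[a b] c] [/= nd /eqP res]|x /= /imfsetP[u /=]]; last first.
    by rewrite inE => /andP[nd /eqP res] ->.
  have aM : (a < M)%N.
    by rewrite ltnNge; apply/negP => /(lam0 c) e; move: nd; rewrite /nodes /= e.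
  have bM' : (b < M')%N by apply: leq_trans nd (leM' _ _).
  apply/imfsetP; exists (c, (Ordinal aM, Ordinal bM')) => //=.
  by rewrite inE /=; apply/andP.
pose f c (a b : nat) : bool := (b < lam c a)%N && (b%:R - a%:R + s c == i).
transitivity (\sum_(u : T) (f u.1 u.2.1 u.2.2 : nat))%N.
  by rewrite -sum1_card big_mkcond; apply: eq_bigr => u _; rewrite inE -/(f _ _ _); case: f.
rewrite -(pair_bigA _ (fun c (v : 'I_M * 'I_M') => f c v.1 v.2 : nat)) /=.
apply: eq_bigr => c _.
rewrite -(pair_bigA _ (fun (a : 'I_M) (b : 'I_M') => f c a b : nat)) /=.
apply: eq_bigr => a _.
rewrite (big_ord_widen M' (fun b => ((b%:R - a%:R + s c == i)%R : nat))) //.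
by rewrite [RHS]big_mkcond; apply: eq_bigr => b _; rewrite /f; case: ifP.
Qed.

(** * Weyl orbits and weights modulo the null root *)

Section WeylOrbits.
Variables (R : realType) (l : nat) (h : realization R l).
Implicit Types (x y : 'Hom(h, R[i]^o)) (D : h).

Lemma simple_reflectionE i x (v : h) :
  simple_reflection i x v = x v - x (coroot h i) * root_ h i v.
Proof. by rewrite !(add_lfunE, opp_lfunE, scale_lfunE). Qed.

Lemma null_root_coroot i : null_root h (coroot h i) = 0.
Proof.
rewrite /null_root sum_lfunE.
rewrite (eq_bigr (fun j => (affine_cartan i j)%:~R)) => [|j _]; last exact: root_coroot.
rewrite -rmorph_sum /= (_ : \sum_j _ = 0) //.
rewrite /affine_cartan !sumrB sumrMnl.
rewrite (eq_bigr (fun j : 'Z_l => (j == i)%:Z)) => [|j _]; last by rewrite eq_sym.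
rewrite sum_eq_op [X in _ - X - _](eq_bigr (fun j : 'Z_l => (j == i - 1)%:Z)).
  by rewrite !sum_eq_op.
by move=> j _; rewrite -subr_eq eq_sym.
Qed.

Lemma null_root_scaling D : is_scaling_element D -> null_root h D = 1.
Proof.
case=> D0 Dj; rewrite /null_root sum_lfunE (bigD1 0) //= D0 big1 ?addr0 //.
Qed.

(** Each simple reflection of a word for [w] is mirrored by [reflect_at] on all columns at once. *)
Lemma weyl_balanced (r : nat) (F : 'I_r -> 'Z_l -> int) w x :
    weyl_group w -> balanced F ->
    (forall i, x (coroot h i) = (\sum_j drop_at (F j) i)%:~R) ->
  exists G, [/\ balanced G, forall j, \sum_i G j i = \sum_i F j i &
    forall i, w x (coroot h i) = (\sum_j drop_at (G j) i)%:~R].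
Proof.
move=> ww bF xF; elim: ww => [|i {}w _ [G [bG sG wG]]]; first by exists F.
exists (fun j => reflect_at i (G j)); split.
- exact: balanced_reflect.
- by move=> j; rewrite sum_reflect_at.
move=> k; rewrite /= simple_reflectionE !wG.
rewrite root_coroot (eq_bigr _ (fun j _ => drop_at_reflect i (G j) k)).
by rewrite sumrB -mulr_suml [RHS]intrB [X in _ = _ - X]intrM.
Qed.

(** Used to make the multiple of the null root an integer: roots take the values 0 and 1 on [D], so
    each reflection changes [x D] by an integer. *)
Lemma weyl_int_scaling D w x : is_scaling_element D -> weyl_group w ->
    (forall i, exists m : int, x (coroot h i) = m%:~R) ->
    (exists m : int, x D = m%:~R) ->
  (forall i, exists m : int, w x (coroot h i) = m%:~R) /\
  exists m : int, w x D = m%:~R.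
Proof.
move=> [D0 Dj] ww xc xD; elim: ww => [|i {}w _ [wc [m wD]]]; first by split.
have [n wi] := wc i; split.
  move=> k; have [p wk] := wc k; exists (p - n * affine_cartan k i).
  rewrite /= simple_reflectionE wk wi.
  by rewrite root_coroot [RHS]intrB [X in _ = _ - X]intrM.
exists (m - n * (i == 0)%:Z).
rewrite /= simple_reflectionE wi wD intrB intrM.
by case: eqVneq => [->|/Dj ->]; rewrite ?D0.
Qed.

(** The coroots and [D] form a basis: the null root kills the coroots but not [D], and the dimension
    is [l + 1]. *)
Lemma lfun_coroot_scaling_eq0 D x : (1 < l)%N -> is_scaling_element D ->
  (forall i, x (coroot h i) = 0) -> x D = 0 -> x = 0.
Proof.
move=> hl hD xc xD; pose X := [seq coroot h i | i : 'Z_l].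
have ker (y : 'Hom(h, R[i]^o)) : (forall i, y (coroot h i) = 0) -> (<<X>> <= lker y)%VS.
  by move=> yc; apply/span_subvP => _ /mapP[i _ ->]; rewrite memv_ker yc.
have frX : free (D :: X).
  rewrite free_cons coroot_free andbT; apply/negP => DX.
  have /subvP/(_ _ DX) := ker _ null_root_coroot.
  by rewrite memv_ker null_root_scaling // oner_eq0.
have full : (<<D :: X>> = fullv)%VS.
  apply/eqP; rewrite eqEdim subvf cartan_alg_dim.
  move: frX; rewrite /free => /eqP ->.
  by rewrite /= size_image card_ord Zp_cast.
apply/lfunP => v; rewrite zero_lfunE; apply/eqP; rewrite -memv_ker.
have : (fullv <= lker x)%VS.
  by rewrite -full span_cons subv_add -memvE memv_ker xD eqxx ker.
by move/subvP/(_ v (memvf v)).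
Qed.

Lemma eq_mod_null_root_scaling D x y : (1 < l)%N -> is_scaling_element D ->
  (forall i, x (coroot h i) = y (coroot h i)) ->
  (exists m : int, x D - y D = m%:~R) -> eq_mod_null_root x y.
Proof.
move=> hl hD xy [m xyD]; exists m; apply/eqP; rewrite -subr_eq0; apply/eqP.
have zE v : (x - y - null_root h *~ m) v = x v - y v - m%:~R * null_root h v.
  by rewrite -scaler_int !(add_lfunE, opp_lfunE, scale_lfunE).
apply: (lfun_coroot_scaling_eq0 hl hD) => [i|].
  by rewrite zE null_root_coroot mulr0 subr0 xy subrr.
by rewrite zE null_root_scaling // mulr1 xyD subrr.
Qed.

End WeylOrbits.

(** * Comparison of the core with the maximal dominant weight *)

Lemma eventually_forall (I : finType) (P : I -> nat -> Prop) :
  (forall i, exists K0, forall K, (K0 <= K)%N -> P i K) ->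
  exists K0, forall K, (K0 <= K)%N -> forall i, P i K.
Proof.
move=> /choice[f fP]; exists (\max_i f i)%N => K leK i.
by apply: fP; apply: leq_trans leK; apply: leq_bigmax.
Qed.

Theorem theoremB (R : realType) (n r l : nat) (hr : (1 <= r)%N) (hl : (2 <= l)%N)
    (h : realization R l) (D : h) (hD : is_scaling_element D)
    (Lam : 'Z_l -> 'Hom(h, R[i]^o)) (hLam : is_fundamental_weights D Lam)
    (g : affineLieAlgebra h)
    (lam : multipartition r) (hlam : multipartition_size lam = n)
    (s : 'I_r -> 'Z_l)
    (L : lieModule g) (hL : is_irreducible_hw_module L (charge_weight Lam s))
    (gam : multipartition r) (s' : 'I_r -> 'Z_l) (hcore : is_core lam s gam s')
    (Lp : 'Hom(h, R[i]^o)) (k : nat) (hLp : is_plus_pair Lam L lam s Lp k) :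
  eq_mod_null_root (charge_weight Lam s') Lp.
Proof.
have charge_coroot (t : 'I_r -> 'Z_l) i :
    charge_weight Lam t (coroot h i) = (\sum_j (t j == i)%:Z)%:~R.
  rewrite /charge_weight sum_lfunE rmorph_sum /=; apply: eq_bigr => j _.
  by rewrite (hLam (t j)).1 -pmulrn.
have charge_D (t : 'I_r -> 'Z_l) : charge_weight Lam t D = 0.
  by rewrite /charge_weight sum_lfunE big1 // => j _; rewrite (hLam (t j)).2.
case: hcore => sigma [c' [B [_ steps term BE s'E]]].
case: hLp => [[_ dom]] [w ww wE].
have [M lam0] : exists M, forall c a, (M <= a)%N -> lam c a = 0%N.
  have /eventually_forall[M hM] := fun c => part_finite (lam c).
  by exists M => c a /hM.
have [Mg gam0] : exists M, forall c a, (M <= a)%N -> gam c a = 0%N.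
  have /eventually_forall[Mg hMg] := fun c => part_finite (gam c).
  by exists Mg => c a /hMg.
have le_max (f : 'I_r -> nat) j : (f j <= \max_c f c)%N by apply: (leq_bigmax j).
have [K1 inv] := total_runner_clos hl steps.
(* A window wide enough for the invariance of the totals and for every column of the initial abacus,
   whose charges are below [l], and of the core. *)
pose K := (K1 + M + l + (\max_c lam c 0) + Mg + (\max_c `|c' c|) + (\max_c gam c 0)).+1%N.
pose F (j : 'I_r) (i : 'Z_l) := runner K (fun k => B (k, j)) i.
have bF : balanced F by apply: terminal_balanced.
have chargeF j : (\sum_i F j i)%:~R - 1 = s' j.
  rewrite s'E /F BE; apply: (@sum_runner_abacus l K Mg (gam j) (c' j) hl (gam0 j)).
  have := le_max (fun c => gam c 0%N) j; have := le_max (fun c => `|c' c|%N) j.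
  rewrite /K; lia.
have dropF i : (\sum_j drop_at (F j) i)
    = \sum_j (s j == i)%:Z - \sum_m affine_cartan i m * (residue_count lam s m)%:Z.
  (* By invariance the drops can be computed on the initial abacus; the sorting permutation then
     only reindexes the sum over columns. *)
  have -> : \sum_j drop_at (F j) i = \sum_j drop_at
      (runner K (fun k => abacus_of (lam \o sigma) (fun j => (s (sigma j) : nat)%:Z) (k, j))) i.
    by rewrite !sum_drop_at_runner !inv //; rewrite /K; lia.
  rewrite (eq_bigr (fun j => (s (sigma j) == i)%:Z - \sum_m affine_cartan i m
      * (node_count M (lam (sigma j)) (s (sigma j)) m)%:Z)) => [|j _]; last first.
    have := @drop_at_runner_abacus l K M (lam (sigma j))
      (s (sigma j) : nat)%:Z hl (lam0 (sigma j)).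
    rewrite -pmulrn natr_Zp; apply.
    have := le_max (fun c => lam c 0%N) (sigma j).
    have : (s (sigma j) < l)%N by rewrite -[X in (_ < X)%N](Zp_cast hl).
    rewrite /K; lia.
  transitivity (\sum_j ((s j == i)%:Z - \sum_m affine_cartan i m
      * (node_count M (lam j) (s j) m)%:Z)).
    by rewrite [RHS](reindex_inj (@perm_inj _ sigma)).
  rewrite sumrB; congr (_ - _); rewrite exchange_big /=; apply: eq_bigr => m _.
  rewrite -mulr_sumr (residue_countE _ _ lam0) -[in RHS]natz natr_sum.
  by congr (_ * _); apply: eq_bigr => j _; rewrite natz.
pose x := charge_weight Lam s - Res h lam s.
have xF i : x (coroot h i) = (\sum_j drop_at (F j) i)%:~R.
  rewrite /x add_lfunE opp_lfunE charge_coroot /Res sum_lfunE dropF intrB.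
  congr (_ - _); rewrite rmorph_sum /=; apply: eq_bigr => m _.
  by rewrite -scaler_nat scale_lfunE root_coroot intrM mulrC -pmulrn.
have [G [bG sG xG]] := weyl_balanced ww bF xF.
have LpG i : Lp (coroot h i) = (\sum_j drop_at (G j) i)%:~R.
  rewrite -xG -/x wE add_lfunE opp_lfunE -scaler_nat scale_lfunE null_root_coroot.
  by rewrite scaler0 subr0.
apply: (eq_mod_null_root_scaling hl hD) => [i|].
  rewrite charge_coroot LpG dominant_balanced //.
    congr (_%:~R); apply: eq_bigr => j _; by rewrite sG chargeF.
  (* Dominance of [Lp] supplies the nonnegativity of the summed drops of [G]. *)
  move=> m; have [q] := dom m; rewrite LpG pmulrn => /eqP.
  by rewrite eqr_int => /eqP ->.
have [|_ [m wD]] := weyl_int_scaling hD ww (fun i => ex_intro _ _ (xF i)).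
  (* Fundamental weights vanish on [D], and among the simple roots only the one of index 0 does
     not. *)
  exists (- (residue_count lam s 0)%:Z).
  rewrite /x add_lfunE opp_lfunE charge_D add0r /Res sum_lfunE (bigD1 0) //=.
  rewrite -scaler_nat scale_lfunE hD.1 big1 => [|j j0].
    by rewrite addr0 [_ *: _]mulr1 intrN -pmulrn.
  by rewrite -scaler_nat scale_lfunE (hD.2 j j0) scaler0.
(* [Lp D] is [m + k], as the null root is 1 on [D]. *)
exists (- (m + k%:Z)); rewrite charge_D sub0r intrN intrD -wD -/x wE.
rewrite add_lfunE opp_lfunE -scaler_nat scale_lfunE null_root_scaling //.
by rewrite [_ *: _]mulr1 -pmulrn subrK.
Qed.
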